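(* Let $p,q$ be positive integers, let $n,t$ be integers with $0\leq t\leq q$, and let $b_1 \leq b_2 \leq \ldots \leq b_n$ be positive integers. For a positive integer $k$ define $N(k)=(q+1)(\lceil q/p\rceil+3)^{k-1}$ if $k\leq p$ and $N(k)=(2(p+q+1))^k$ if $k>p$. Assume there exists a positive integer $k$ such that (i) $\gcd(p+q,\ell)\leq p$ for every $1\leq \ell \leq k$; (ii) $n\geq N(k)$; (iii) $b_{N(k)} \leq k$. Then Enforcer has a winning strategy in the game $mBox(b_1, \ldots, b_n,(p,q))$ as the first player, even if in his first move he claims only $t$ elements (instead of $q$).
   Context: A $(p,q)$ Avoider-Enforcer game (strict rules): Avoider and Enforcer alternately claim exactly $p$ and exactly $q$ previously unclaimed board elements per move, respectively; a player facing fewer unclaimed elements than his bias claims all of them; the game ends when all elements are claimed; Avoider loses (Enforcer wins) if at the end Avoider has claimed all elements of some target set. $mBox(b_1,\ldots,b_n,(p,q))$ is this game on the disjoint union of pairwise disjoint boxes $B_1,\ldots,B_n$ with $|B_i|=b_i$, with target sets exactly $B_1,\ldots,B_n$. *)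

(* Defs.v *)
From mathcomp Require Import all_boot.

Set Implicit Arguments.
Unset Strict Implicit.
Unset Printing Implicit Defensive.

(* The strict (p, q) Avoider-Enforcer game on the board T with target sets F,
   Enforcer moving first and claiming t elements (instead of q) in his first
   move.  A history is the sequence of the sets claimed in successive moves:
   Enforcer makes the moves of even index, Avoider those of odd index. *)
Section AvoiderEnforcer.
Variables (T : finType) (F : {set {set T}}) (p q t : nat).
Implicit Types (h : seq {set T}) (X : {set T}).

Definition enforcer_turn h : bool := ~~ odd (size h).

Definition claimed h : {set T} := \bigcup_(X <- h) X.

Definition avoider_claimed h : {set T} :=
  \bigcup_(i < size h | odd i) nth set0 h i.

Definition game_over h : bool := claimed h == [set: T].

Definition bias h : nat :=
  if h is [::] then t else if enforcer_turn h then q else p.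

Definition legal_move h X : bool :=
  [&& ~~ game_over h, X \subset ~: claimed h
    & #|X| == minn (bias h) #|~: claimed h|].

Definition legal_history h : Prop :=
  forall i, i < size h -> legal_move (take i h) (nth set0 h i).

Definition enforcer_wins h : Prop :=
  exists2 X, X \in F & X \subset avoider_claimed h.

Definition strategy := seq {set T} -> {set T}.

Definition enforcer_strategy (s : strategy) : Prop :=
  forall h, legal_history h -> enforcer_turn h -> ~~ game_over h ->
    legal_move h (s h).

Definition follows (s : strategy) h : Prop :=
  forall i, i < size h -> enforcer_turn (take i h) ->
    nth set0 h i = s (take i h).

(* For p, q > 0 every move after the first claims an element, so every history
   extends to a finished one and the last clause covers all plays. *)
Definition enforcer_has_winning_strategy : Prop :=
  exists s : strategy,
    enforcer_strategy s /\
    forall h, legal_history h -> follows s h -> game_over h -> enforcer_wins h.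

End AvoiderEnforcer.

Section Boxes.
Variables (n : nat) (b : n.-tuple nat).

(* The disjoint union of n boxes, the i-th one having tnth b i elements. *)
Definition mbox_board : finType := {i : 'I_n & 'I_(tnth b i)}.

Definition mbox_box (i : 'I_n) : {set mbox_board} := [set x | tag x == i].

Definition mbox_targets : {set {set mbox_board}} :=
  [set mbox_box i | i : 'I_n].

End Boxes.

Definition ceil_div (m d : nat) : nat := (m + d.-1) %/ d.

Lemma ceil_div_leq m d c : 0 < d -> (ceil_div m d <= c) = (m <= c * d).
Proof.
move=> d_gt0; rewrite -ltnS ltn_divLR // mulSn addnC.
by case: d d_gt0 => // d _; rewrite !addSn ltnS leq_add2l.
Qed.

Definition mbox_threshold (p q k : nat) : nat :=
  if k <= p then (q + 1) * (ceil_div q p + 3) ^ (k - 1)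
  else (2 * (p + q + 1)) ^ k.

(* Main.v *)
Require Import Defs.
From mathcomp Require Import all_boot zify.

Set Implicit Arguments.
Unset Strict Implicit.
Unset Printing Implicit Defensive.

(** Call a box among the first N(k) live while Enforcer has not touched it, and
    call the free elements outside the live boxes junk. Enforcer claims junk as
    long as there is some and otherwise breaks up a largest live box, so that
    after breaking up a box of size m he leaves fewer than m elements of junk
    and only live boxes of size at most m. Give a live box with s free elements
    the weight C^(k-s): Enforcer wins if the total weight never reaches 0, for
    then some live box survives until it is entirely claimed by Avoider.

    If k <= p then m <= p, hence Avoider has to take at least p-m+1 elements of
    live boxes in each move, and with C = ceil(q/p)+3 this makes up for the at
    most ceil(q/m) boxes just broken up.

    If k > p, Avoider may answer inside the junk. But as long as he does so and
    only boxes of size m are broken up, the amount of junk changes by -(p+q)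
    modulo m in every round; as gcd(p+q,m) <= p, it drops below p before more
    than p+q boxes are lost, and then Avoider has to touch a live box, which
    with C = 2(p+q+1) pays for the loss. The losses left unpaid when the maximal
    size m decreases add up to less than the initial weight C^k. *)

(** By Bezout some multiple of [m] is congruent to [- gcdn P m] modulo [P]; adding it [J %/ g] times
    leaves the residue [J %% g]. *)
Lemma small_residue_shift P m J : 0 < P ->
  exists2 a, a <= P & (J + a * m) %% P < gcdn P m.
Proof.
move=> P_gt0; have [u _ dvdP] := Bezoutl m P_gt0.
have g_gt0 : 0 < gcdn P m by rewrite gcdn_gt0 P_gt0.
set g := gcdn P m in dvdP g_gt0 *.
exists (J %/ g * u %% P); first by rewrite ltnW ?ltn_pmod.
rewrite -modnDmr modnMml modnDmr.
have -> : J + J %/ g * u * m = J %/ g * (g + u * m) + J %% g.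
  by rewrite {1}(divn_eq J g) mulnDr mulnA; lia.
have /dvdnP[c ->] : P %| J %/ g * (g + u * m) by rewrite dvdn_mull.
by rewrite modnMDl (leq_ltn_trans (leq_mod _ _)) ?ltn_pmod.
Qed.

Lemma broken_count_le x m j a : 0 < x -> j < m -> x * m <= j + a -> x <= a.
Proof. move=> *; nia. Qed.

(** * Positions: junk, greedy moves and the potential *)

Section BoxPositions.
Variables (T I : finType) (tg : T -> I).
Implicit Types (S : {set I}) (U X Y : {set T}).

Definition bsize U i := #|[set x in U | tg x == i]|.

Definition junk S U := #|[set x in U | tg x \notin S]|.

Definition survivors S X := S :\: (tg @: X).

(** A whole move is described by its outcome, not by the order of its claims. Box sizes are those
    before the move, and the remains of broken boxes already count as junk. *)
Definition greedy S U X :=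
  [forall i in S :&: (tg @: X),
     (junk (survivors S X) (U :\: X) < bsize U i)
     && [forall j in survivors S X, bsize U j <= bsize U i]].

Definition bounded m S U := forall i, i \in S -> bsize U i <= m.

Definition nonempty_boxes S U := forall i, i \in S -> 0 < bsize U i.

Definition potential C K S U := \sum_(i in S) C ^ (K - bsize U i).

Lemma card_junk_bsize S U : #|U| = junk S U + \sum_(i in S) bsize U i.
Proof.
rewrite -sum1_card (bigID (fun x => tg x \in S)) /= addnC; congr addn.
  by rewrite sum1dep_card; apply: eq_card => x; rewrite !inE.
rewrite (partition_big tg (mem S)) => [|x /andP[]] //=.
apply: eq_bigr => i Si; rewrite sum1dep_card /bsize; apply: eq_card => x.
by rewrite !inE; case: eqP => [->|]; rewrite ?Si ?andbT ?andbF.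
Qed.

Lemma bsize_le U U' i : U' \subset U -> bsize U' i <= bsize U i.
Proof.
move=> /subsetP sU; apply/subset_leq_card/subsetP => x.
by rewrite !inE => /andP[/sU -> ->].
Qed.

Lemma bounded_sub m S S' U U' :
  S' \subset S -> U' \subset U -> bounded m S U -> bounded m S' U'.
Proof.
move=> /subsetP sS sU bd i /sS /bd; apply: leq_trans; exact: bsize_le.
Qed.

Lemma junk_le S U U' : U' \subset U -> junk S U' <= junk S U.
Proof.
move=> /subsetP sU; apply/subset_leq_card/subsetP => x.
by rewrite !inE => /andP[/sU -> ->].
Qed.

Lemma bsize_survivor S U X i :
  i \in survivors S X -> bsize (U :\: X) i = bsize U i.
Proof.
rewrite inE => /andP[iNX _]; apply: eq_card => x; rewrite !inE.
case: eqP => [xi|]; rewrite ?andbF // !andbT.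
case Xx: (x \in X) => //=; case/imsetP: iNX.
by exists x.
Qed.

Lemma bsize_gt0 U i : 0 < bsize U i -> exists2 x, x \in U & tg x = i.
Proof. by case/card_gt0P=> x; rewrite !inE => /andP[Ux /eqP]; exists x. Qed.

Lemma leq_card_free S U : nonempty_boxes S U -> #|S| <= #|U|.
Proof.
move=> pos; rewrite (card_junk_bsize S) -sum1_card.
by apply: leq_trans (leq_addl _ _); apply: leq_sum.
Qed.

Lemma greedyP S U X i : greedy S U X -> i \in S -> i \in tg @: X ->
  junk (survivors S X) (U :\: X) < bsize U i /\
  forall j, j \in survivors S X -> bsize U j <= bsize U i.
Proof.
move=> /forall_inP g Si Xi; have := g i; rewrite inE Si => /(_ Xi).
by case/andP=> ? /forall_inP.
Qed.

Lemma greedy_extend S U X : X \proper U -> greedy S U X ->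
  exists2 y, y \in U :\: X & greedy S U (y |: X).
Proof.
move=> /properP[sXU [y0 Uy0 Xy0]] gX.
have [y|no_junk] :=
  pickP (mem [set x in U :\: X | tg x \notin survivors S X]).
  rewrite /= inE => /andP[UXy yS]; exists y => //.
  have eqS : survivors S (y |: X) = survivors S X.
    apply/setP=> i; rewrite /survivors imsetU1 !inE.
    move: yS; rewrite !inE negb_and negbK.
    by case: eqVneq => [<-|] //= /orP[->|/negbTE->]; rewrite ?andbF.
  apply/forall_inP=> i; rewrite inE imsetU1 !inE eqS => /andP[Si Xi].
  have {}Xi : i \in tg @: X.
    case/orP: Xi => // /eqP eqi; move: yS.
    by rewrite inE negb_and negbK -eqi Si orbF.
  have [j1 j2] := greedyP gX Si Xi.
  apply/andP; split; last by apply/forall_inP.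
  apply: leq_ltn_trans j1; apply: junk_le; apply: setDS; exact: subsetUr.
have Sy0 : tg y0 \in survivors S X.
  by have := no_junk y0; rewrite /= !inE Xy0 Uy0 /= => /negbFE.
(* No junk is left, so a largest surviving box [i] is broken up; afterwards the junk is at most box
   [i] without [y]. *)
case: (arg_maxnP (fun i => bsize U i) Sy0) => i /= Si maxi.
have {}Si : i \in survivors S X by [].
have {}maxi j : j \in survivors S X -> bsize U j <= bsize U i by apply: maxi.
have /bsize_gt0[y Uy yi] : 0 < bsize U i.
  apply: leq_trans (maxi _ Sy0); apply/card_gt0P; exists y0.
  by rewrite !inE Uy0 /=.
have Xy : y \notin X.
  move: Si; rewrite inE => /andP[iX _]; apply: contra iX => Xy.
  by rewrite -yi imset_f.
exists y; first by rewrite inE Xy.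
have lt_i : junk (survivors S (y |: X)) (U :\: (y |: X)) < bsize U i.
  rewrite /bsize (cardsD1 y) !inE Uy yi eqxx ltnS.
  apply/subset_leq_card/subsetP=> x; rewrite !inE => /andP[].
  rewrite negb_or => /andP[/andP[xy xX] xU].
  rewrite xy xU /= imsetU1 !inE yi.
  have := no_junk x; rewrite /= !inE xX xU /= => /negbFE/andP[xS1 xS2].
  by rewrite xS2 (negbTE xS1) andbT orbF negbK.
apply/forall_inP=> j; rewrite inE imsetU1 !inE yi => /andP[Sj Xj].
have le_ij : bsize U i <= bsize U j.
  case/orP: Xj => [/eqP-> //|Xj].
  by have [_] := greedyP gX Sj Xj; apply.
rewrite (leq_trans lt_i le_ij); apply/forall_inP=> l.
rewrite inE imsetU1 !inE negb_or => /andP[/andP[_ Xl] Sl].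
by apply: leq_trans le_ij; apply: maxi; rewrite inE Xl.
Qed.

Lemma greedy_exists S U a : a <= #|U| ->
  exists X, [/\ X \subset U, #|X| = a & greedy S U X].
Proof.
elim: a => [_|a IHa lt_aU].
  exists set0; rewrite sub0set cards0; split=> //.
  by apply/forall_inP=> i; rewrite imset0 setI0 inE.
have [X [sXU cX gX]] := IHa (ltnW lt_aU).
have [|y] := @greedy_extend S U X _ gX.
  by rewrite properEcard sXU cX.
rewrite inE => /andP[Xy Uy] gy; exists (y |: X); split=> //.
  by rewrite subUset sub1set Uy.
by rewrite cardsU1 Xy cX.
Qed.

(** Either [X] lies in the junk, or [x] boxes are broken, the smallest of size [m]. Counting free
    elements before and after gives the junk balance, exact if no live box exceeds [m], since then
    all broken boxes have size [m]. *)
Lemma greedy_outcome C K S U X : 0 < C -> X \subset U -> greedy S U X ->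
  let S' := survivors S X in let U' := U :\: X in
  [/\ S' = S, potential C K S U' = potential C K S U
    & junk S U = junk S U' + #|X|] \/
  exists m x,
    [/\ 0 < x, junk S' U' < m,
        exists2 i, i \in S & bsize U i = m,
        bounded m S' U'
      & [/\ potential C K S U <= potential C K S' U' + x * C ^ (K - m),
            junk S U + x * m <= junk S' U' + #|X|
          & bounded m S U ->
            junk S U + x * m = junk S' U' + #|X|]].
Proof.
move=> C_gt0 sXU gX S' U'.
have cardU : #|U| = #|U'| + #|X|.
  by rewrite addnC cardsD (setIidPr sXU) subnKC ?subset_leq_card.
have balance : junk S U + \sum_(i in S :&: (tg @: X)) bsize U i =
               junk S' U' + #|X|.
  have := cardU; rewrite (card_junk_bsize S U) (card_junk_bsize S' U').
  rewrite (big_setID (tg @: X)) /= -/(survivors S X) -/S'.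
  have -> : \sum_(i in S') bsize U' i = \sum_(i in S') bsize U i.
    by apply: eq_bigr => i; apply: bsize_survivor.
  lia.
have [K0|[i0 Ki0]] := set_0Vmem (S :&: (tg @: X)).
  have eqS : S' = S by apply/setDidPl; rewrite -setI_eq0 K0.
  left; split=> //.
    by apply: eq_bigr => i Si; rewrite (@bsize_survivor S) // -/S' eqS.
  by move: balance; rewrite K0 big_set0 addn0 eqS.
right; case: (arg_minnP (fun i => bsize U i) Ki0) => i Ki mini.
have [Si Xi] := setIP Ki; have [ltJ leS] := greedyP gX Si Xi.
exists (bsize U i), #|S :&: (tg @: X)|; split=> //.
- by apply/card_gt0P; exists i.
- by exists i.
- by move=> j Sj; rewrite (bsize_survivor _ Sj) leS.
split.
- rewrite /potential (big_setID (tg @: X)) /= addnC leq_add //.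
    by apply: leq_sum => j Sj; rewrite (bsize_survivor _ Sj).
  rewrite -sum_nat_const; apply: leq_sum => j Kj.
  by rewrite leq_pexp2l // leq_sub2l // mini.
- by rewrite -balance leq_add2l -sum_nat_const leq_sum.
- move=> leU; rewrite -balance -sum_nat_const; congr addn; apply: eq_bigr => j Kj.
  by apply/eqP; rewrite eqn_leq mini // leU //; case/setIP: Kj.
Qed.

Lemma bernoulli_leq C d : 0 < C -> d * (C - 1) + 1 <= C ^ d.
Proof.
move=> C_gt0; elim: d => // d IHd; rewrite expnS.
have : C * (d * (C - 1) + 1) <= C * C ^ d by rewrite leq_mul2l IHd orbT.
apply: leq_trans; case: C C_gt0 {IHd} => // C _; rewrite subSS subn0; nia.
Qed.

(** Here [d] counts the elements of [Y] in live boxes. Losing [e] elements multiplies the weight of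
    a box by [C ^ e], which by Bernoulli gains at least [e * (C - 1)] times its old weight, itself
    at least [C ^ (K - m)]. *)
Lemma potential_gain C K m S U Y : 0 < C -> m <= K -> Y \subset U ->
  bounded m S U ->
  exists2 d, junk S U + d = junk S (U :\: Y) + #|Y| &
    potential C K S U + d * (C - 1) * C ^ (K - m) <= potential C K S (U :\: Y).
Proof.
move=> C_gt0 le_mK sYU le_m; pose U' := U :\: Y.
have sU' : U' \subset U by apply: subsetDl.
exists (\sum_(i in S) (bsize U i - bsize U' i)).
  have : #|U| = #|U'| + #|Y|.
    by rewrite addnC cardsD (setIidPr sYU) subnKC ?subset_leq_card.
  rewrite (card_junk_bsize S U) (card_junk_bsize S U').
  have -> : \sum_(i in S) bsize U i =
      \sum_(i in S) bsize U' i + \sum_(i in S) (bsize U i - bsize U' i).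
    by rewrite -big_split; apply: eq_bigr => i _; rewrite /= subnKC // bsize_le.
  rewrite -/U'; lia.
rewrite -mulnA big_distrl /= /potential -big_split /=; apply: leq_sum => i Si.
have le_i := bsize_le i sU'; have le_im := le_m _ Si.
have -> : K - bsize U' i = (K - bsize U i) + (bsize U i - bsize U' i) by lia.
rewrite expnD; move: (bsize U i - _) => d.
have : C ^ (K - bsize U i) * (d * (C - 1) + 1) <= C ^ (K - bsize U i) * C ^ d.
  by rewrite leq_mul2l bernoulli_leq // orbT.
apply: leq_trans.
have : d * ((C - 1) * C ^ (K - m)) <= d * ((C - 1) * C ^ (K - bsize U i)).
  by rewrite !leq_mul2l leq_pexp2l ?orbT // leq_sub2l.
nia.
Qed.

Lemma potential_le C K S U : 0 < C -> nonempty_boxes S U ->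
  potential C K S U <= #|S| * C ^ (K - 1).
Proof.
move=> C_gt0 pos; rewrite -sum_nat_const; apply: leq_sum => i Si.
by rewrite leq_pexp2l // leq_sub2l // pos.
Qed.

Lemma card_le_potential C K S U : 0 < C -> #|S| <= potential C K S U.
Proof.
by move=> C_gt0; rewrite -sum1_card; apply: leq_sum => i Si; rewrite expn_gt0 C_gt0.
Qed.

End BoxPositions.

Section Invariants.
Variables (T I : finType) (tg : T -> I) (p q K : nat).
Hypotheses (p_gt0 : 0 < p) (K_gt0 : 0 < K).
Implicit Types (S : {set I}) (U X Y : {set T}).

Local Notation bounded := (bounded tg).
Local Notation nonempty_boxes := (nonempty_boxes tg).
Local Notation bsize := (bsize tg).
Local Notation junk := (junk tg).
Local Notation survivors := (survivors tg).
Local Notation greedy := (greedy tg).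
Local Notation potential := (potential tg).

(** * The invariant for [K <= p] *)

Section SmallBoxes.
Hypothesis le_Kp : K <= p.
Let C := ceil_div q p + 3.

(** The bound is N(K), met at the start because every box weighs at least 1. As a nonempty box
    weighs at most [C ^ (K - 1)], it also guarantees more than [q] live boxes. *)
Definition small_enforcer S U :=
  bounded K S U /\ (q + 1) * C ^ (K - 1) <= potential C K S U.

(* In the second case, Enforcer has just broken up [x] boxes of size at least
   [m] and Avoider is about to pay for them. *)
Definition small_avoider S U :=
  [/\ bounded K S U, 0 < potential C K S U
    & (q + 1) * C ^ (K - 1) <= potential C K S U \/
      exists m x, [/\ 0 < m <= K, junk S U < m, bounded m S U, x * m < q + m
        & (q + 1) * C ^ (K - 1) <= potential C K S U + x * C ^ (K - m)]].

Lemma small_base_gt0 : 0 < C. Proof. by rewrite /C addn3. Qed.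

Lemma small_enforcer_move S U X : small_enforcer S U -> X \subset U ->
  #|X| <= q -> greedy S U X -> small_avoider (survivors S X) (U :\: X).
Proof.
move=> [bd pot] sXU leXq gX.
have bd' : bounded K (survivors S X) (U :\: X).
  by apply: bounded_sub bd; apply: subsetDl.
have W_gt0 : 0 < C ^ (K - 1) by rewrite expn_gt0 small_base_gt0.
have [[eqS eqpot _]|] := greedy_outcome K small_base_gt0 sXU gX.
  rewrite eqS in bd' *; split; rewrite ?eqpot //; last by left.
  by apply: leq_trans pot; rewrite muln_gt0 addn1.
move=> [m [x [x_gt0 ltJm [i Si szi] bdm [loss le_x _]]]].
have le_mK : m <= K by rewrite -szi bd.
have m_gt0 : 0 < m by apply: leq_ltn_trans ltJm.
have le_xq : x <= q.
  by apply: leq_trans leXq; apply: broken_count_le ltJm _ => //; lia.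
have le_W : C ^ (K - m) <= C ^ (K - 1) by rewrite leq_pexp2l ?small_base_gt0 //; lia.
(* At most [q] boxes of weight at most [C ^ (K - 1)] are lost, so the potential stays positive. *)
split=> //; first by nia.
by right; exists m, x; split=> //; [rewrite m_gt0 | lia | lia].
Qed.

Lemma small_avoider_move S U Y : small_avoider S U -> Y \subset U ->
  #|Y| = p -> small_enforcer S (U :\: Y).
Proof.
move=> [bd _ inv] sYU cY.
split; first by apply: bounded_sub bd; rewrite ?subsetDl.
case: inv => [le_pot|[m [x [/andP[m_gt0 le_mK] ltJm bdm lt_x le_pot]]]].
  have [d _] := potential_gain small_base_gt0 (leqnn K) sYU bd; lia.
have [d eq_d gain] := potential_gain small_base_gt0 le_mK sYU bdm.
have ceilP : q <= ceil_div q p * p by rewrite -ceil_div_leq.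
(* With fewer than [m] elements of junk, [d >= p - m + 1]. Since [m <= p], this gives [m * d >= p],
   hence [m * d * (C - 1) >= q + 2 * m > x * m]. *)
have le_xd : x <= d * (C - 1).
  have ge_d : p - m + 1 <= d by lia.
  have le_p : p <= m * (p - m + 1) by nia.
  have -> : C - 1 = ceil_div q p + 2 by rewrite /C; lia.
  have : q + 2 * m <= m * (d * (ceil_div q p + 2)).
    have le_md : p <= m * d by apply: leq_trans le_p _; rewrite leq_mul2l ge_d orbT.
    have le_c : ceil_div q p * p <= ceil_div q p * (m * d).
      by rewrite leq_mul2l le_md orbT.
    have le_m : m <= m * d by rewrite leq_pmulr //; lia.
    by rewrite mulnA mulnDr (mulnC (m * d) (ceil_div q p)); lia.
  have : x * m < q + m := lt_x.
  rewrite mulnC; move: (d * _) => e; nia.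
apply: leq_trans le_pot (leq_trans _ gain).
by rewrite leq_add2l leq_mul2r le_xd orbT.
Qed.

Lemma small_enforcer_card S U : small_enforcer S U -> nonempty_boxes S U ->
  q < #|S|.
Proof.
move=> [_ pot] pos; have := leq_trans pot (potential_le K small_base_gt0 pos).
by rewrite leq_pmul2r ?addn1 // expn_gt0 small_base_gt0.
Qed.

Lemma small_avoider_alive S U : small_avoider S U -> S != set0.
Proof.
by move=> [_ pot _]; apply: contraTneq pot => ->; rewrite /potential big_set0.
Qed.

End SmallBoxes.

(** * The invariant under the gcd hypothesis *)

Section LargeBoxes.
Hypothesis small_gcd : forall l, 1 <= l <= K -> gcdn (p + q) l <= p.
Let C := 2 * (p + q + 1).

(** The potential may lie below [C ^ K] by less than [C ^ (K - m)]: no deficit at all for [m = K],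
    and an allowance growing by the factor [C] whenever [m] drops by one. *)
Definition large_safe S U :=
  exists m, [/\ 0 < m <= K, bounded m S U
    & C ^ K < potential C K S U + C ^ (K - m)].

(* [large_cycle j]: with [j] elements of junk on the board and all live boxes of
   size at most [m], Avoider can play inside the junk only until Enforcer has
   broken up [a] further boxes of size [m], because then fewer than [p] elements
   of junk are left; the potential still affords these [a] losses. *)
Definition large_cycle j S U :=
  exists m a, [/\ 0 < m <= K, bounded m S U, j < m, (j + a * m) %% (p + q) < p
    & C ^ K + a * C ^ (K - m) < potential C K S U + C * C ^ (K - m)].

(** Adding [p] restores the amount of junk before an Avoider move inside the junk, so such a move
    keeps the cycle data. *)
Definition large_enforcer S U := large_safe S U \/ large_cycle (junk S U + p) S U.

Definition large_avoider S U := large_safe S U \/ large_cycle (junk S U) S U.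

Lemma large_base_gt0 : 0 < C. Proof. by rewrite /C; lia. Qed.

(** Starts a cycle after [x] boxes were broken: [small_residue_shift] yields some [a <= p + q], and
    [C] is chosen so that [x + 1 + a <= C], covering both past and future losses. *)
Lemma large_reset S U m x : 0 < m <= K -> bounded m S U -> junk S U < m ->
  x <= q -> C ^ K < potential C K S U + (x + 1) * C ^ (K - m) ->
  large_cycle (junk S U) S U.
Proof.
move=> lemK bd ltJm le_x pot.
have [|a le_a lt_a] := @small_residue_shift (p + q) m (junk S U); first by lia.
exists m, a; split=> //; first exact: leq_trans lt_a (small_gcd lemK).
have : (x + 1 + a) * C ^ (K - m) <= C * C ^ (K - m).
  by rewrite leq_mul2r; apply/orP; right; rewrite /C; lia.
lia.
Qed.

Lemma large_safe_move S U X : large_safe S U -> X \subset U ->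
  #|X| <= q -> greedy S U X -> large_avoider (survivors S X) (U :\: X).
Proof.
move=> [m0 [lemK bd pot]] sXU leXq gX.
have [[eqS eqpot _]|] := greedy_outcome K large_base_gt0 sXU gX.
  left; exists m0; rewrite eqS; split; rewrite ?eqpot //.
  by apply: bounded_sub bd; rewrite ?subsetDl.
move=> [m [x [x_gt0 ltJm [i Si szi] bdm [loss le_x _]]]].
have le_m : m <= m0 by rewrite -szi bd.
have le_W : C ^ (K - m0) <= C ^ (K - m) by rewrite leq_pexp2l ?large_base_gt0 //; lia.
right; apply: (@large_reset _ _ m x) => //; first by lia.
  by apply: leq_trans leXq; apply: broken_count_le ltJm _ => //; lia.
rewrite mulnDl mul1n; lia.
Qed.

(** Within a cycle, a round inside the junk that breaks [x] boxes of size [m] changes the junk by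
    [x * m - (p + q)], so the residue is kept when [a] drops by [x]. Breaking a smaller box starts a
    new cycle, whose larger unit [C ^ (K - m)] absorbs the whole old allowance. *)
Lemma large_enforcer_move S U X : large_enforcer S U -> X \subset U ->
  #|X| = q -> greedy S U X -> large_avoider (survivors S X) (U :\: X).
Proof.
move=> inv sXU cX gX; case: inv => [safe|]; first by apply: large_safe_move; rewrite ?cX.
move=> [m0 [a [lemK bd ltJp lt_a pot]]].
have [[eqS eqpot eqJ]|] := greedy_outcome K large_base_gt0 sXU gX.
  right; exists m0, a; rewrite eqS; split; rewrite ?eqpot //.
  - by apply: bounded_sub bd; rewrite ?subsetDl.
  - lia.
  - by rewrite -modnDr; apply: etrans lt_a; congr (_ %% _ < p); lia.
move=> [m [x [x_gt0 ltJm [i Si szi] bdm [loss le_x eq_x]]]].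
have le_m : m <= m0 by rewrite -szi bd.
have le_xq : x <= q by rewrite -cX; apply: broken_count_le ltJm _ => //; lia.
right; case: (ltngtP m m0) le_m => // [lt_m _|eq_m _].
  apply: (@large_reset _ _ m x) => //; first by lia.
  have le_W : C * C ^ (K - m0) <= C ^ (K - m).
    by rewrite -expnS leq_pexp2l ?large_base_gt0 //; lia.
  rewrite mulnDl mul1n; lia.
rewrite {}eq_m in szi ltJm bdm loss le_x eq_x *; move: eq_x => /(_ bd).
rewrite cX => eqJ.
(* Otherwise [junk S U + p + a * m0] lies between [p] and [p + q], and its residue is not below
   [p]. *)
have le_xa : x <= a.
  rewrite leqNgt; apply/negP => lt_ax.
  have ltP : junk S U + p + a * m0 < p + q by nia.
  by move: lt_a; rewrite modn_small //; lia.
exists m0, (a - x); split=> //.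
  rewrite -modnDr; apply: etrans lt_a; congr (_ %% _ < p).
  by rewrite mulnBl; have := leq_mul le_xa (leqnn m0); lia.
rewrite mulnBl; have := leq_mul le_xa (leqnn (C ^ (K - m0))); lia.
Qed.

(** A single element of a live box gains [(C - 1) * C ^ (K - m)], which turns the cycle allowance
    [C * C ^ (K - m)] into the safe one. *)
Lemma large_avoider_move S U Y : large_avoider S U -> Y \subset U ->
  #|Y| = p -> large_enforcer S (U :\: Y).
Proof.
move=> inv sYU cY.
have bd' m : bounded m S U -> bounded m S (U :\: Y).
  by apply: bounded_sub; rewrite ?subsetDl.
case: inv => [[m [/andP[m_gt0 le_mK] bd pot]]|].
  have [d _ gain] := potential_gain large_base_gt0 le_mK sYU bd.
  by left; exists m; split; rewrite ?m_gt0 //; [exact: bd' | lia].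
move=> [m [a [/andP[m_gt0 le_mK] bd ltJm lt_a pot]]].
have [d eqJ gain] := potential_gain large_base_gt0 le_mK sYU bd.
have [d0|d_gt0] := posnP d.
  have eqJp : junk S (U :\: Y) + p = junk S U by lia.
  right; exists m, a; rewrite eqJp; split; rewrite ?m_gt0 //; first exact: bd'.
  lia.
left; exists m; split; rewrite ?m_gt0 //; first exact: bd'.
have : C * C ^ (K - m) <= (d * (C - 1) + 1) * C ^ (K - m).
  by rewrite leq_mul2r; apply/orP; right; have := large_base_gt0; nia.
rewrite mulnDl mul1n; lia.
Qed.

Lemma large_enforcer_card S U : large_enforcer S U -> nonempty_boxes S U ->
  q < #|S|.
Proof.
move=> inv pos; have W_gt0 : 0 < C ^ (K - 1) by rewrite expn_gt0 large_base_gt0.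
have eqCK : C ^ K = C * C ^ (K - 1) by rewrite -expnS subn1 prednK.
have pot : C ^ K < potential C K S U + C ^ (K - 1).
  case: inv => [[m [lemK bd pot]]|[m [a [lemK bd ltm _ pot]]]].
    apply: leq_trans pot _; rewrite leq_add2l leq_pexp2l ?large_base_gt0 //; lia.
  (* Here [junk S U + p < m] and [0 < p] force [m >= 2]. *)
  have : C * C ^ (K - m) <= C ^ (K - 1).
    by rewrite -expnS leq_pexp2l ?large_base_gt0 //; lia.
  lia.
have := potential_le K large_base_gt0 pos => le_S.
have : C * C ^ (K - 1) < (#|S| + 1) * C ^ (K - 1) by rewrite mulnDl mul1n; lia.
by rewrite ltn_pmul2r // /C; lia.
Qed.

Lemma large_avoider_alive S U : large_avoider S U -> S != set0.
Proof.
move=> inv; suff : 0 < potential C K S U.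
  by apply: contraTneq => ->; rewrite /potential big_set0.
have le_m m : 0 < m <= K -> C * C ^ (K - m) <= C ^ K.
  by rewrite -expnS => lemK; rewrite leq_pexp2l ?large_base_gt0 //; lia.
case: inv => [[m [lemK _ pot]]|[m [a [lemK _ _ _ pot]]]].
  by have := le_m _ lemK; have := leq_pmull (C ^ (K - m)) large_base_gt0; lia.
have := le_m _ lemK; lia.
Qed.

End LargeBoxes.
End Invariants.

(** * Extending histories by one move *)

Section Histories.
Variables (T : finType) (p q t : nat).
Implicit Types (h : seq {set T}) (X : {set T}).

Lemma claimed_rcons h X : claimed (rcons h X) = claimed h :|: X.
Proof. by rewrite /claimed big_rcons /= setUC. Qed.

Lemma avoider_claimed_rcons h X : avoider_claimed (rcons h X) =
  avoider_claimed h :|: (if odd (size h) then X else set0).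
Proof.
rewrite /avoider_claimed size_rcons big_mkcond big_ord_recr /= -big_mkcond /=.
rewrite nth_rcons ltnn eqxx; congr (_ :|: _).
by apply: eq_bigr => i _; rewrite nth_rcons ltn_ord.
Qed.

Lemma avoider_claimed_sub h : avoider_claimed h \subset claimed h.
Proof.
elim/last_ind: h => [|h X IHh]; first by rewrite /avoider_claimed big_ord0 sub0set.
rewrite claimed_rcons avoider_claimed_rcons setUSS //.
by case: ifP => // _; apply: sub0set.
Qed.

Lemma legal_history_rcons h X : legal_history p q t (rcons h X) ->
  legal_history p q t h /\ legal_move p q t h X.
Proof.
move=> lh; split=> [i lt_ih|].
  have := lh i; rewrite size_rcons nth_rcons lt_ih -cats1 takel_cat ?(ltnW lt_ih) //.
  by apply; apply: ltnW.
have := lh (size h); rewrite size_rcons nth_rcons ltnn eqxx -cats1 take_size_cat //.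
exact.
Qed.

Lemma follows_rcons (s : strategy T) h X : follows s (rcons h X) ->
  follows s h /\ (enforcer_turn h -> X = s h).
Proof.
move=> fh; split=> [i lt_ih|].
  have := fh i; rewrite size_rcons nth_rcons lt_ih -cats1 takel_cat ?(ltnW lt_ih) //.
  by apply; apply: ltnW.
have := fh (size h); rewrite size_rcons nth_rcons ltnn eqxx -cats1 take_size_cat //.
exact.
Qed.

End Histories.

(** * From invariants to a winning strategy *)

Section GreedyStrategy.
Variables (T I : finType) (tg : T -> I) (F : {set {set T}}) (S0 : {set I}).
Variables (p q t : nat).
Hypothesis le_tq : t <= q.
Hypothesis box_target : forall i, [set x | tg x == i] \in F.
Implicit Types (h : seq {set T}) (S : {set I}) (U X Y : {set T}).

(* The boxes of [S0] that Enforcer has not touched. *)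
Definition live h :=
  [set i in S0 | [set x | tg x == i] \subset ~: claimed h :|: avoider_claimed h].

Lemma live_nil : live [::] = S0.
Proof.
apply/setP=> i; rewrite inE /claimed big_nil setC0 setTU subsetT.
by rewrite andbT.
Qed.

Lemma live_enforcer h X : ~~ odd (size h) -> X \subset ~: claimed h ->
  live (rcons h X) = survivors tg (live h) X.
Proof.
move=> /negbTE ev sX; apply/setP=> i.
rewrite !inE claimed_rcons avoider_claimed_rcons ev setU0.
case: (i \in S0); rewrite ?andbF //=.
apply/subsetP/andP => [sub|[iX /subsetP sub] x xi].
  split; last first.
    by apply/subsetP=> x /sub; rewrite !inE negb_or; case: (x \in claimed h).
  apply/imsetP=> -[x Xx eqi]; have := sub x; rewrite !inE eqi eqxx => /(_ isT).
  rewrite Xx orbT /= => Ax; have := subsetP sX x Xx.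
  by rewrite inE (subsetP (avoider_claimed_sub h)).
have := sub x xi; rewrite !inE negb_or; case: (boolP (x \in X)) => [Xx|]; last by rewrite andbT.
by case/imsetP: iX; exists x => //; move: xi; rewrite inE => /eqP.
Qed.

Lemma live_avoider h Y : odd (size h) -> Y \subset ~: claimed h ->
  live (rcons h Y) = live h.
Proof.
move=> od sY; rewrite /live claimed_rcons avoider_claimed_rcons od.
suff -> : ~: (claimed h :|: Y) :|: (avoider_claimed h :|: Y) =
          ~: claimed h :|: avoider_claimed h by [].
apply/setP=> x; rewrite !inE.
have := subsetP sY x; rewrite inE.
by case: (x \in Y) => [/(_ isT)->|_]; rewrite ?orbT ?orbF.
Qed.

Lemma enforcer_wins_live h i : i \in live h -> bsize tg (~: claimed h) i = 0 ->
  enforcer_wins F h.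
Proof.
rewrite inE => /andP[_ /subsetP sub] /eqP; rewrite cards_eq0 => /eqP sz0.
exists [set x | tg x == i] => //; apply/subsetP=> x xi.
have := sub x xi; rewrite inE => /orP[Cx|//].
have : x \in set0 by rewrite -sz0 inE Cx; move: xi; rewrite inE.
by rewrite inE.
Qed.

Lemma enforcer_wins_rcons h X : enforcer_wins F h -> enforcer_wins F (rcons h X).
Proof.
move=> [Z FZ sZ]; exists Z => //; apply: subset_trans sZ _.
by rewrite avoider_claimed_rcons subsetUl.
Qed.

(** The default [set0] does not occur before the end of the game, by [greedy_exists]. *)
Definition greedy_strategy h : {set T} :=
  odflt set0 [pick X | legal_move p q t h X && greedy tg (live h) (~: claimed h) X].

Lemma greedy_strategyP h : ~~ game_over h ->
  legal_move p q t h (greedy_strategy h) /\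
  greedy tg (live h) (~: claimed h) (greedy_strategy h).
Proof.
move=> nover; rewrite /greedy_strategy; case: pickP => [X /andP[] //|none].
have [|X [sX cX gX]] := @greedy_exists _ _ tg (live h) (~: claimed h)
   (minn (bias p q t h) #|~: claimed h|); first exact: geq_minr.
by have := none X; rewrite /legal_move nover sX cX eqxx gX.
Qed.

Variables start enforcer_inv avoider_inv : {set I} -> {set T} -> Prop.
Hypothesis start_nonempty : nonempty_boxes tg S0 [set: T].
Hypothesis start_init : start S0 [set: T].
Hypothesis start_inv : forall S U, start S U -> enforcer_inv S U.
Hypothesis start_move : forall S U X, start S U -> X \subset U -> #|X| <= q ->
  greedy tg S U X -> avoider_inv (survivors tg S X) (U :\: X).
Hypothesis enforcer_move : forall S U X, enforcer_inv S U -> X \subset U ->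
  #|X| = q -> greedy tg S U X -> avoider_inv (survivors tg S X) (U :\: X).
Hypothesis avoider_move : forall S U Y, avoider_inv S U -> Y \subset U ->
  #|Y| = p -> enforcer_inv S (U :\: Y).
Hypothesis enforcer_card : forall S U, enforcer_inv S U ->
  nonempty_boxes tg S U -> q < #|S|.
Hypothesis avoider_alive : forall S U, avoider_inv S U -> S != set0.

(** Once Avoider exhausts a live box the game is decided; until then every move after the first has
    full size and the invariants apply. The separate [start] accounts for the first move of only [t]
    elements. *)
Lemma greedy_invariant h : legal_history p q t h -> follows greedy_strategy h ->
  enforcer_wins F h \/
  nonempty_boxes tg (live h) (~: claimed h) /\
  (if odd (size h) then avoider_inv else enforcer_inv) (live h) (~: claimed h).
Proof.
elim/last_ind: h => [|h X IHh].
  rewrite live_nil /claimed big_nil setC0; right; split=> //=; exact: start_inv.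
move=> /legal_history_rcons[lh lX] /follows_rcons[fh eqX].
have [win|[pos inv]] := IHh lh fh; first by left; apply: enforcer_wins_rcons.
have /and3P[nover sX /eqP cX] := lX.
have eqU : ~: claimed (rcons h X) = ~: claimed h :\: X.
  by rewrite claimed_rcons setCU setDE.
have {IHh} := inv; rewrite size_rcons /=; case: ifPn => /= [od aI|ev eI].
  have eqS := live_avoider od sX.
  have [/forall_inP pos'|] :=
      boolP [forall i in live h, 0 < bsize tg (~: claimed h :\: X) i].
    right; rewrite eqS eqU; split=> //; apply: avoider_move => //.
    have h_cons : bias p q t h = p.
      by case: (h) od => //= Z h'; rewrite /enforcer_turn /= => ->.
    have /set0Pn[i Si] := avoider_alive aI.
    have /bsize_gt0[x] := pos' i Si; rewrite inE => /andP[xX xU] _.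
    (* With fewer than [p] free elements Avoider would claim them all, but [x] stays free. *)
    move: cX; rewrite h_cons => cX; rewrite cX; apply/minn_idPl; rewrite leqNgt.
    apply: contra xX => lt_p; move: cX; rewrite (minn_idPr (ltnW lt_p)) => cX.
    by have /eqP-> : X == ~: claimed h by rewrite eqEcard sX cX leqnn.
  rewrite negb_forall => /existsP[i]; rewrite negb_imply -eqn0Ngt =>
     /andP[Si /eqP sz0].
  by left; apply: (@enforcer_wins_live _ i); rewrite ?eqS ?eqU.
have eqS := live_enforcer ev sX.
have gX : greedy tg (live h) (~: claimed h) X.
  by rewrite eqX //; case: (greedy_strategyP nover).
right; rewrite eqS eqU; split.
  by move=> i Si; rewrite (bsize_survivor _ Si); apply: pos;
    move: Si; rewrite inE => /andP[].
case: h {lh fh eqX eqU eqS inv nover lX} pos sX cX ev eI gX =>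
  [|Z h'] pos sX cX ev eI gX.
  apply: start_move => //; first by rewrite live_nil /claimed big_nil setC0.
  by rewrite cX (leq_trans (geq_minl _ _)).
(* More than [q] nonempty live boxes leave enough free elements for a full move. *)
apply: enforcer_move => //; rewrite cX /bias /enforcer_turn ev; apply/minn_idPl.
apply: leq_trans (ltnW (enforcer_card eI pos)) _; exact: leq_card_free pos.
Qed.

(** At the end nothing is free, whereas the invariant would provide a live box with a free element;
    only the winning alternative remains. *)
Lemma greedy_strategy_wins : enforcer_has_winning_strategy F p q t.
Proof.
exists greedy_strategy; split=> [h _ _ /greedy_strategyP[] //|h lh fh over].
have [//|[pos inv]] := greedy_invariant lh fh.
have /set0Pn[i Si] : live h != set0.
  move: inv; case: ifP => _ inv; first exact: avoider_alive inv.
  by rewrite -card_gt0 (leq_trans _ (enforcer_card inv pos)).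
have := pos i Si => /bsize_gt0[x].
by move/eqP: over => ->; rewrite setCT inE.
Qed.

End GreedyStrategy.

(** * Application to the box game *)

Lemma card_mbox_box n (b : n.-tuple nat) (i : 'I_n) :
  #|mbox_box b i| = tnth b i.
Proof.
have -> : mbox_box b i =
    [set (Tagged (fun j => 'I_(tnth b j)) y : mbox_board b) | y : 'I_(tnth b i)].
  apply/setP=> x; rewrite inE; apply/eqP/imsetP => [<-|[y _ ->] //].
  by exists (tagged x) => //; rewrite taggedK.
rewrite card_imset ?card_ord // => y z /eqP; rewrite -tag_eqE /tag_eq eqxx /=.
by rewrite tagged_asE => /eqP.
Qed.

Theorem theorem2p3 (p q n t : nat) (b : n.-tuple nat)
  (p_gt0 : 0 < p) (q_gt0 : 0 < q) (t_le_q : t <= q)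
  (b_gt0 : forall i : 'I_n, 0 < tnth b i)
  (b_sorted : forall i j : 'I_n, i <= j -> tnth b i <= tnth b j)
  (k_exists : exists k : nat,
     [/\ 0 < k,
         forall l : nat, 1 <= l <= k -> gcdn (p + q) l <= p,
         mbox_threshold p q k <= n
       & (* b is indexed from 0: this is b_{N(k)} <= k *)
         nth 0 b (mbox_threshold p q k - 1) <= k]) :
  enforcer_has_winning_strategy (mbox_targets b) p q t.
Proof.
have [k [k_gt0 small_gcd le_Nn le_bk]] := k_exists.
set N := mbox_threshold p q k in le_Nn le_bk.
pose tg (x : mbox_board b) := tag x.
(* Only the [N] smallest boxes are watched; all have size at most [k]. *)
pose S0 := [set i : 'I_n | i < N].
have szT i : bsize tg [set: mbox_board b] i = tnth b i.
  by rewrite -card_mbox_box; apply: eq_card => x; rewrite !inE.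
have cardS0 : #|S0| = N.
  have -> : S0 = [set widen_ord le_Nn j | j : 'I_N].
    apply/setP=> i; rewrite inE; apply/idP/imsetP => [lt_iN|[j _ ->]];
      last exact: ltn_ord j.
    by exists (Ordinal lt_iN) => //; apply: val_inj.
  by rewrite card_imset ?card_ord // => i j /(congr1 val) /= /val_inj.
have bd : bounded tg k S0 [set: mbox_board b].
  move=> i; rewrite inE szT => lt_iN; apply: leq_trans le_bk.
  have lt_N1 : N - 1 < n by lia.
  have := b_sorted i (Ordinal lt_N1); rewrite !(tnth_nth 0) /=; apply; lia.
have pos i : i \in S0 -> 0 < bsize tg [set: mbox_board b] i by rewrite szT.
have targets i : [set x | tg x == i] \in mbox_targets b by apply/imsetP; exists i.
have [le_kp|lt_pk] := leqP k p.
  apply: (@greedy_strategy_wins _ _ tg _ S0 p q t t_le_q targets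
            (small_enforcer tg p q k) (small_enforcer tg p q k)
            (small_avoider tg p q k)) => //.
  - split=> //; apply: leq_trans (card_le_potential _ _ _ _ _); last by rewrite addn3.
    by rewrite cardS0 /N /mbox_threshold le_kp.
  - exact: small_enforcer_move.
  - by move=> S U X inv sX cX; apply: small_enforcer_move; rewrite ?cX.
  - exact: small_avoider_move.
  - exact: small_enforcer_card.
  - exact: small_avoider_alive.
apply: (@greedy_strategy_wins _ _ tg _ S0 p q t t_le_q targets
          (large_safe tg p q k) (large_enforcer tg p q k)
          (large_avoider tg p q k)) => //.
(* For [m = k] the allowance is [C ^ 0 = 1], so a potential of at least [N = C ^ k] suffices. *)
- exists k; split=> //; first by rewrite k_gt0 leqnn.
  rewrite subnn [_ + _ ^ 0]addn1 ltnS.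
  apply: leq_trans (card_le_potential _ _ _ _ _); last by rewrite /=; lia.
  by rewrite cardS0 /N /mbox_threshold [k <= p]leqNgt lt_pk.
- by move=> S U; left.
- exact: large_safe_move.
- exact: large_enforcer_move.
- exact: large_avoider_move.
- exact: large_enforcer_card.
- exact: large_avoider_alive.
Qed.
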